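(* Let $p,q,r\in\mathbb{Z}$ with $r\neq 0$ and let $a=(a_n)_{n=0}^\infty$ be the standard linear divisibility sequence of order $4$ over $\mathbb{Z}$ with parameters $p,q,r$. Then $a_n=b_nc_n$ for all $n\ge 0$, where $b=(b_n)_{n=0}^\infty$ and $c=(c_n)_{n=0}^\infty$ are linear divisibility sequences of order $2$ over $\mathbb{C}$ with initial conditions $0,1$ and with characteristic polynomials as follows. (i) If $p\neq 0$, the characteristic polynomials of $b$ and $c$ are, respectively, $$x^{2}-\frac{\sqrt{q+4r+2p\sqrt{r}}\pm\sqrt{q+4r-2p\sqrt{r}}}{2\sqrt{r}}\,x+1,\qquad x^{2}-\frac{\sqrt{q+4r+2p\sqrt{r}}\mp\sqrt{q+4r-2p\sqrt{r}}}{2}\,x+r,$$ where the upper signs are taken together or the lower signs are taken together. (ii) If $p=0$, $q+4r\neq 0$ and $q\neq 0$, there are two possible families of characteristic polynomials for $b$ and $c$, namely $$x^{2}+1,\quad x^{2}-\sqrt{q+4r}\,x+r,$$ and $$x^{2}+1,\quad x^{2}-\sqrt{q}\,x-r.$$ Moreover, up to equivalence of product sequences, these are all the factorizations of $a$ over $\mathbb{C}$ as a product of two linear divisibility sequences of order $2$ with initial conditions $0,1$.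
   Context: A sequence $a=(a_n)_{n=0}^\infty$ over a ring $\mathcal{R}$ is a divisibility sequence if $m\mid n$ implies $a_m\mid a_n$ in $\mathcal{R}$; conventionally $a_0=0$. A linear divisibility sequence (LDS) is a divisibility sequence satisfying a linear recurrence with constant coefficients. An LDS of order $2$ with initial conditions $0,1$ and characteristic polynomial $x^2-hx+k$ is the sequence with $u_0=0$, $u_1=1$, $u_{n+2}=hu_{n+1}-ku_n$. The standard LDS of order $4$ over $\mathbb{Z}$ with parameters $p,q,r\in\mathbb{Z}$ is the linear recurrence sequence with characteristic polynomial $x^{4}-px^{3}+(q+2r)x^{2}-prx+r^{2}$ and initial conditions $a_0=0$, $a_1=1$, $a_2=p$, $a_3=p^{2}-q-3r$. Square roots denote complex square roots, with one fixed choice of each of $\sqrt{r}$, $\sqrt{q+4r+2p\sqrt r}$, $\sqrt{q+4r-2p\sqrt r}$, $\sqrt{q+4r}$, $\sqrt q$ used in all occurrences. Equivalence: given sequences $(u_n),(v_n),(s_n),(t_n)$ (indexed by $n\ge0$) over a ring $\mathcal{R}$, the product sequences $(u_nv_n)$ and $(s_nt_n)$ are equivalent if there is a unit $\lambda\in\mathcal{R}$ with $u_n=\lambda^{n-1}s_n$ and $v_n=\lambda^{1-n}t_n$ for all $n$; here $\mathcal{R}=\mathbb{C}$. The order of the two factors is immaterial in a factorization.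
   Formalization: In (ii) the two families are only alternatives: a factors by at least one, and every factorization is equivalent to one from either. The second never factors a, as its third term is -(q+r) while a_3=-(q+3r) and r≠0, so the first always does. *)

(* Defs.v *)
From HB Require Import structures.
From mathcomp Require Import all_boot all_order all_algebra.
From mathcomp Require Import reals.
From mathcomp Require Import complex.

Set Implicit Arguments.
Unset Strict Implicit.
Unset Printing Implicit Defensive.

Import Order.TTheory GRing.Theory Num.Theory.
Local Open Scope ring_scope.

Definition divisibility_seq (K : comNzRingType) (a : nat -> K) : Prop :=
  forall m n : nat, (m %| n)%N -> exists z : K, a n = z * a m.

Definition recurrence_with_charpoly (K : comNzRingType) (P : {poly K})
    (a : nat -> K) : Prop :=
  P \is monic /\
  forall n : nat, \sum_(i < size P) P`_i * a (n + i)%N = 0.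

(* The order is the degree of P, hence [size P = 3].  It is automatically the
   minimal order: a first-order recurrence starting at 0 never reaches 1. *)
Definition lds2 (K : comNzRingType) (P : {poly K}) (u : nat -> K) : Prop :=
  [/\ divisibility_seq u, recurrence_with_charpoly P u,
      size P = 3%N, u 0%N = 0 & u 1%N = 1].

Definition standard_lds4 (p q r : int) (a : nat -> int) : Prop :=
  recurrence_with_charpoly
    ('X^4 - p *: 'X^3 + (q + 2 * r) *: 'X^2 - (p * r) *: 'X + (r ^+ 2)%:P) a
  /\ [/\ a 0%N = 0, a 1%N = 1, a 2%N = p & a 3%N = p ^+ 2 - q - 3 * r].

Definition factorization (K : comNzRingType) (a : nat -> int)
    (B C : {poly K}) (b c : nat -> K) : Prop :=
  [/\ lds2 B b, lds2 C c & forall n : nat, (a n)%:~R = b n * c n].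

(* The exponents n - 1 and 1 - n are integers: at n = 0 they are -1 and 1. *)
Definition equivalent_products (K : comUnitRingType)
    (u v s t : nat -> K) : Prop :=
  exists2 l : K, l \is a GRing.unit &
    forall n : nat, u n = l ^ (n%:Z - 1) * s n /\ v n = l ^ (1 - n%:Z) * t n.

Definition equivalent_factorizations (K : comUnitRingType)
    (u v s t : nat -> K) : Prop :=
  equivalent_products u v s t \/ equivalent_products v u s t.

(* Main.v *)
Require Import Defs.
From HB Require Import structures.
From mathcomp Require Import all_boot all_order all_algebra.
From mathcomp Require Import reals.
From mathcomp Require Import complex.
From mathcomp Require Import ring.

Set Implicit Arguments.
Unset Strict Implicit.
Unset Printing Implicit Defensive.

Import Order.TTheory GRing.Theory Num.Theory.
Local Open Scope ring_scope.

(** The idea is to trade sequences for their parameters.  Write [u(h,k)] for the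
    sequence 0, 1, ... with characteristic polynomial [X^2 - h X + k].

    - The termwise product of [u(h,k)] and [u(h',k')] is the standard sequence
      of order 4 with parameters [p = h h'], [q = k' h^2 + k h'^2 - 4 k k'] and
      [r = k k'] ([lucas_product]): if [x, y] and [x', y'] are the roots of the
      two quadratics, these are the symmetric functions of [xx', xy', yx', yy'].
    - Conversely, if [r] is nonzero and either [p] or [q + 4 r] is nonzero, a
      standard sequence determines its parameters ([std4_inj]).  Under these
      conditions, factoring the sequence amounts to solving the three equations
      above for [h, k, h', k'].
    - Replacing [(h,k)] and [(h',k')] by [(h/l, k/l^2)] and [(l h', l^2 k')] is
      exactly equivalence of products ([lucas_scale]), so taking [l^2 = k] one
      may assume [k = 1] and [k' = r].  What remains is [h h' = p] and
      [r h^2 + h'^2 = q + 4 r], which say together that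
      [(sqrt r * h + h')^2 = q + 4 r + 2 p sqrt r] and
      [(sqrt r * h - h')^2 = q + 4 r - 2 p sqrt r].
      These are solved by extracting two square roots.  The sign of the first
      one is absorbed in the choice of the square root [l] of [k]
      ([sqrt_matching]), the sign of the second one is the sign [e] of the theorem.
    - When [p = 0] one of [h], [h'] vanishes.  Listing that factor first, the
      normalized equations become [h = 0] and [h'^2 = q + 4 r], so every
      factorization is equivalent to the one with polynomials [X^2 + 1] and
      [X^2 - sqrt (q + 4 r) X + r].

    Every [u(h,k)] is a divisibility sequence by the addition formula
    ([lucas_add]). *)

(** * Sequences given by their parameters *)

Definition is_lucas (K : comNzRingType) (h k : K) (u : nat -> K) : Prop :=
  [/\ u 0 = 0, u 1 = 1 & forall n, u n.+2 = h * u n.+1 - k * u n].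

Definition is_std4 (K : comNzRingType) (p q r : K) (a : nat -> K) : Prop :=
  [/\ a 0 = 0, a 1 = 1, a 2 = p, a 3 = p ^+ 2 - q - 3 * r
    & forall n, a n.+4 = p * a n.+3 - (q + 2 * r) * a n.+2
                         + p * r * a n.+1 - r ^+ 2 * a n].

Definition lucas (K : comNzRingType) (h k : K) (n : nat) : K :=
  (iter n (fun x => (x.2, h * x.2 - k * x.1)) (0, 1)).1.

Section CommutativeRing.

Variable K : comNzRingType.
Implicit Types (h k p q r : K) (u v a : nat -> K) (P : {poly K}).

Lemma lucasP h k : is_lucas h k (lucas h k).
Proof. by split. Qed.

(** A two-step recurrence needs two consecutive terms as induction hypothesis;
    the same holds for the other proofs by induction on such sequences. *)
Lemma lucas_add h k u : is_lucas h k u ->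
  forall m n, u (m + n).+1 = u m.+1 * u n.+1 - k * u m * u n.
Proof.
move=> [u0 u1 urec] m n.
suff [] : u (m + n).+1 = u m.+1 * u n.+1 - k * u m * u n /\
          u (m + n).+2 = u m.+2 * u n.+1 - k * u m.+1 * u n by [].
elim: m => [|m [IH1 IH2]]; first by rewrite !add0n !urec u0 u1; split; ring.
by rewrite addSn; split=> //; rewrite urec IH1 IH2 !urec; ring.
Qed.

Lemma lucas_divisibility h k u : is_lucas h k u -> divisibility_seq u.
Proof.
move=> uP m _ /dvdnP[j ->]; have [u0 _ _] := uP.
case: m => [|m]; first by exists 0; rewrite muln0 u0 mulr0.
elim: j => [|j [z zE]]; first by exists 0; rewrite u0 mul0r.
exists (u (j * m.+1).+1 - k * z * u m).
by rewrite mulSn addnC addnS (lucas_add uP) zE; ring.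
Qed.

Lemma lucas_product h k h' k' u v :
    is_lucas h k u -> is_lucas h' k' v ->
  is_std4 (h * h') (k' * h ^+ 2 + k * h' ^+ 2 - 4 * (k * k')) (k * k')
    (fun n => u n * v n).
Proof.
move=> [u0 u1 urec] [v0 v1 vrec].
by split=> [||||n]; rewrite !(urec, vrec, u0, v0, u1, v1); ring.
Qed.

Lemma std4_ext p q r a a' : is_std4 p q r a -> is_std4 p q r a' -> a =1 a'.
Proof.
move=> [a0 a1 a2 a3 arec] [b0 b1 b2 b3 brec] n.
suff [] : [/\ a n = a' n, a n.+1 = a' n.+1, a n.+2 = a' n.+2
            & a n.+3 = a' n.+3] by [].
elim: n => [|n [e0 e1 e2 e3]]; first by rewrite a0 a1 a2 a3.
by split=> //; rewrite arec brec e0 e1 e2 e3.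
Qed.

(** * Parameters and characteristic polynomials *)

(** [size] and the coefficients of a polynomial written with [+] and ['X] do not
    compute, whereas those of a list of coefficients do. *)
Lemma recurrence_seq (s : seq K) P a :
    P = Poly s -> last 0 s = 1 ->
  recurrence_with_charpoly P a <->
    forall n, \sum_(i < size s) s`_i * a (n + i)%N = 0.
Proof.
move=> -> s1.
have Ps : Poly s = s :> seq K by apply: (@PolyK _ 0); rewrite s1 oner_eq0.
split=> [[_]|Prec]; rewrite /recurrence_with_charpoly Ps //.
by split=> //; rewrite monicE /lead_coef Ps nth_last s1.
Qed.

Lemma lucas_polyE h k :
  'X^2 - h *: 'X + k%:P = Poly [:: k; - h; 1] :> {poly K}.
Proof.
by rewrite /= !cons_poly_def polyC0 polyCN polyC1 -mul_polyC; ring.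
Qed.

Lemma lucas_lds2 h k u :
  is_lucas h k u -> lds2 ('X^2 - h *: 'X + k%:P) u.
Proof.
move=> uP; have [u0 u1 urec] := uP; split=> //.
- exact: lucas_divisibility uP.
- apply/(recurrence_seq _ (lucas_polyE h k)) => // n.
  rewrite !big_ord_recl big_ord0 /= /bump /= addn0 addn1 addn2 urec.
  by ring.
- by rewrite lucas_polyE (@PolyK _ 0) //= oner_eq0.
Qed.

Lemma lds2_lucas P u : lds2 P u -> exists h k, is_lucas h k u.
Proof.
move=> [_ [Pmonic Prec] Psize u0 u1]; exists (- P`_1), P`_0; split=> // n.
have P2 : P`_2 = 1 by move/monicP: Pmonic; rewrite /lead_coef Psize.
have := Prec n; rewrite Psize !big_ord_recl big_ord0 /= /bump /=.
rewrite !addn0 addn1 addn2 P2 => rec0.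
by apply: subr0_eq; rewrite -[RHS]rec0; ring.
Qed.

End CommutativeRing.

Lemma standard_lds4_std4 (p q r : int) (a : nat -> int) :
  standard_lds4 p q r a -> is_std4 p q r a.
Proof.
move=> [arec [a0 a1 a2 a3]]; split=> // n.
have PE : 'X^4 - p *: 'X^3 + (q + 2 * r) *: 'X^2 - (p * r) *: 'X
          + (r ^+ 2)%:P
        = Poly [:: r ^+ 2; - (p * r); q + 2 * r; - p; 1] :> {poly int}.
  by rewrite /= !cons_poly_def polyC0 !polyCN polyC1 -!mul_polyC; ring.
have /(_ n) := (recurrence_seq a PE erefl).1 arec.
rewrite !big_ord_recl big_ord0 /= /bump /= !addnS addn0 => rec0.
by apply: subr0_eq; rewrite -[RHS]rec0; ring.
Qed.

Lemma std4_intr (K : comNzRingType) (p q r : int) (a : nat -> int) :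
    is_std4 p q r a ->
  is_std4 p%:~R q%:~R r%:~R (fun n => (a n)%:~R : K).
Proof.
move=> [a0 a1 a2 a3 arec].
split=> [||||n]; rewrite ?a0 ?a1 ?a2 ?a3 ?arec //.
  by rewrite !(rmorphB, rmorphM, rmorphXn, mulrz_nat).
by rewrite !(rmorphB, rmorphD, rmorphM, rmorphXn, mulrz_nat).
Qed.

(** * A standard sequence determines its parameters *)

(** For nonzero [p] the parameters are read off from [a_2], [a_3], [a_4].
    For [p = 0] only the odd terms survive; they satisfy a recurrence of order
    2, and [a_3^2 - a_1 a_5 = r (q + 4 r)].  So the hypotheses say that this
    recurrence is minimal, and then four of its terms determine it. *)
Lemma std4_inj (K : idomainType) (p q r p' q' r' : K) (a : nat -> K) :
    2%:R != 0 :> K -> r != 0 -> (p != 0) || (q + 4 * r != 0) ->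
    is_std4 p q r a -> is_std4 p' q' r' a ->
  [/\ p' = p, q' = q & r' = r].
Proof.
move=> two0 r0 nz [a0 a1 a2 a3 arec] [_ _ b2 b3 brec].
have pE : p' = p by rewrite -a2 -b2.
rewrite {p' b2}pE in b3 brec *.
have qE : q' = q + 3 * r - 3 * r'.
  by apply: subr0_eq; rewrite -(subrr (a 3)) {2}b3 a3; ring.
suff rE : r' = r by rewrite qE rE; split=> //; ring.
have b4 := brec 0; rewrite !arec a0 a1 a2 a3 qE in b4.
move/eqP: b4; rewrite -subr_eq0 => /eqP b4.
have [p0|p0] := eqVneq p 0; last first.
  have /eqP : 2%:R * p * (r - r') = 0 by rewrite -[RHS]b4; ring.
  by rewrite !mulf_eq0 (negPf two0) (negPf p0) subr_eq0 => /eqP.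
rewrite p0 eqxx /= in nz.
have b5 := brec 1; have b7 := brec 3.
rewrite !arec a0 a1 a2 a3 qE p0 in b5 b7.
move/eqP: b5; rewrite -subr_eq0 => /eqP b5.
move/eqP: b7; rewrite -subr_eq0 => /eqP b7.
have /eqP : (r' - r) * (r' + (q + 4 * r)) = 0 by rewrite -[RHS]b5; ring.
rewrite mulf_eq0 => /orP[|]; first by rewrite subr_eq0 => /eqP.
(* [r' = - (q + 4 r)] agrees up to [a_5]; it is [a_7] that tells it from [r],
   unless the two values coincide. *)
rewrite addr_eq0 => /eqP r'E; rewrite r'E in b7 *.
have /eqP : - r * (q + 4 * r) * (q + 4 * r + r) = 0 by rewrite -[RHS]b7; ring.
rewrite !mulf_eq0 oppr_eq0 (negPf r0) (negPf nz) /= addr_eq0 => /eqP ->.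
by rewrite opprK.
Qed.

(** * Normalization of a product *)

Lemma lucas_scale (K : fieldType) (l h k : K) (s u : nat -> K) :
    l != 0 -> is_lucas h k s -> is_lucas (l * h) (l ^+ 2 * k) u ->
  forall n : nat, u n = l ^ (n%:Z - 1) * s n.
Proof.
move=> l0 [s0 s1 srec] [u0 u1 urec] [|n]; first by rewrite u0 s0 mulr0.
rewrite -addn1 PoszD addrK addn1 -exprnP.
suff [] : u n.+1 = l ^+ n * s n.+1 /\ u n.+2 = l ^+ n.+1 * s n.+2 by [].
elim: n => [|n [IH1 IH2]].
  by rewrite urec srec u0 u1 s0 s1 expr0 expr1; split; ring.
by split=> //; rewrite urec IH1 IH2 (srec n.+1) !exprS; ring.
Qed.

Lemma normalized_product (K : fieldType) (l h k h' k' : K) (u v : nat -> K) :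
    l != 0 -> l ^+ 2 = k -> is_lucas h k u -> is_lucas h' k' v ->
  equivalent_products u v (lucas (h / l) 1) (lucas (l * h') (k * k')).
Proof.
move=> l0 <- uP vP; exists l; first by rewrite unitfE.
move=> n; split.
  by apply: (lucas_scale l0 (lucasP _ _) _ n); rewrite mulr1 mulrC divfK.
rewrite -opprB -exprz_inv.
apply: lucas_scale (lucasP _ _) _ n; first by rewrite invr_eq0.
by rewrite mulKf // exprVn mulKf // expf_neq0.
Qed.

(** The two square roots of [k] differ by a sign, so one of them matches the
    sign with which [d] was chosen. *)
Lemma sqrt_matching (K : numClosedFieldType) (k d x : K) :
  d ^+ 2 * k = x ^+ 2 -> exists2 l : K, l ^+ 2 = k & d * l = x.
Proof.
move=> dkE; have /eqP : (d * sqrtC k) ^+ 2 = x ^+ 2 by rewrite exprMn sqrtCK.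
rewrite eqf_sqr => /orP[] /eqP xE; first by exists (sqrtC k); rewrite ?sqrtCK.
by exists (- sqrtC k); rewrite ?sqrrN ?sqrtCK // mulrN xE opprK.
Qed.

(** For a suitable square root [l] of [k], division by [l] makes the hypotheses
    say that [sr * h / l + l * h'] is [dp] and that [sr * h / l - l * h'] is a
    square root of [dm ^+ 2]. *)
Lemma normalized_parameters (K : numClosedFieldType) (h k h' k' sr dp dm : K) :
    k * k' != 0 -> sr ^+ 2 = k * k' ->
    dp ^+ 2 = k' * h ^+ 2 + k * h' ^+ 2 + 2 * (h * h') * sr ->
    dm ^+ 2 = k' * h ^+ 2 + k * h' ^+ 2 - 2 * (h * h') * sr ->
  exists (l : K) (e : bool),
    [/\ l ^+ 2 = k, h / l = (dp + (-1) ^+ e * dm) / (2 * sr)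
      & l * h' = (dp - (-1) ^+ e * dm) / 2].
Proof.
move=> r0 srE dpE dmE.
have k0 : k != 0 by apply: contraNneq r0 => ->; rewrite mul0r.
have sr0 : sr != 0 by apply: contraNneq r0 => sr0; rewrite -srE sr0 expr0n.
have [l lE dplE] : exists2 l : K, l ^+ 2 = k & dp * l = sr * h + k * h'.
  by apply: sqrt_matching; rewrite dpE sqrrD !exprMn srE; ring.
have l0 : l != 0 by apply: contraNneq k0 => l0; rewrite -lE l0 expr0n.
have dpl : dp = sr * (h / l) + l * h'.
  by apply: (mulIf l0); rewrite dplE -lE; field.
have /eqP : dm ^+ 2 = (sr * (h / l) - l * h') ^+ 2.
  rewrite dmE sqrrB !exprMn srE exprVn lE; field; exact/andP.
rewrite eqf_sqr => dmP.
have [e eE] : exists e : bool, (-1) ^+ e * dm = sr * (h / l) - l * h'.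
  case/orP: dmP => /eqP ->; [exists false | exists true]; ring.
exists l, e; rewrite eE dpl; split=> //; field; last by [].
by rewrite sr0 l0.
Qed.

(** * Factorizations of a standard sequence *)

Section Factorizations.

Variables (K : fieldType) (p q r : int) (a : nat -> int).
Hypothesis aP : is_std4 p q r a.
Implicit Types (h k : K) (u v : nat -> K).

Lemma factorizationP h k h' k' :
    h * h' = p%:~R -> k' * h ^+ 2 + k * h' ^+ 2 - 4 * (k * k') = q%:~R ->
    k * k' = r%:~R ->
  factorization a ('X^2 - h *: 'X + k%:P) ('X^2 - h' *: 'X + k'%:P)
    (lucas h k) (lucas h' k').
Proof.
move=> pE qE rE; have [uP vP] := (lucasP h k, lucasP h' k').
split; [exact: lucas_lds2 | exact: lucas_lds2 |].
apply: std4_ext (std4_intr K aP) _.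
by rewrite -pE -qE -rE; apply: lucas_product.
Qed.

(** The product of the factors is standard for its own parameters and for
    [p, q, r], so the two triples coincide. *)
Lemma factorization_parameters (U V : {poly K}) u v :
    2%:R != 0 :> K -> r%:~R != 0 :> K ->
    (p%:~R != 0 :> K) || (q%:~R + 4 * r%:~R != 0 :> K) ->
    factorization a U V u v ->
  exists h k h' k', [/\ is_lucas h k u, is_lucas h' k' v, h * h' = p%:~R,
    k' * h ^+ 2 + k * h' ^+ 2 - 4 * (k * k') = q%:~R & k * k' = r%:~R].
Proof.
move=> two0 r0 nz [/lds2_lucas[h [k uP]] /lds2_lucas[h' [k' vP]] aE].
exists h, k, h', k'.
have [c0 c1 c2 c3 crec] := std4_intr K aP.
have uvP : is_std4 p%:~R q%:~R r%:~R (fun n => u n * v n).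
  by split=> [||||n]; rewrite -!aE.
by have [-> -> ->] := std4_inj two0 r0 nz uvP (lucas_product uP vP).
Qed.

End Factorizations.

Theorem theorem3 (R : realType) (p q r : int) (a : nat -> int)
  (sqrt_r sqrt_plus sqrt_minus sqrt_q4r sqrt_q : R[i])
  (r_neq0 : r <> 0)
  (a_std : standard_lds4 p q r a)
  (sqrt_rE : sqrt_r ^+ 2 = r%:~R)
  (sqrt_plusE : sqrt_plus ^+ 2 = (q + 4 * r)%:~R + 2 * p%:~R * sqrt_r)
  (sqrt_minusE : sqrt_minus ^+ 2 = (q + 4 * r)%:~R - 2 * p%:~R * sqrt_r)
  (sqrt_q4rE : sqrt_q4r ^+ 2 = (q + 4 * r)%:~R)
  (sqrt_qE : sqrt_q ^+ 2 = q%:~R) :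
  let rC : R[i] := r%:~R in
  (* (i): [e] selects the upper (false) or the lower (true) signs *)
  let B1 (e : bool) : {poly R[i]} :=
    'X^2 - ((sqrt_plus + (-1) ^+ e * sqrt_minus) / (2 * sqrt_r)) *: 'X + 1 in
  let C1 (e : bool) : {poly R[i]} :=
    'X^2 - ((sqrt_plus - (-1) ^+ e * sqrt_minus) / 2) *: 'X + rC%:P in
  (* (ii): the two possible families *)
  let B2 : {poly R[i]} := 'X^2 + 1 in
  let C2 : {poly R[i]} := 'X^2 - sqrt_q4r *: 'X + rC%:P in
  let B3 : {poly R[i]} := 'X^2 + 1 in
  let C3 : {poly R[i]} := 'X^2 - sqrt_q *: 'X - rC%:P in
  [/\ exists (B C : {poly R[i]}) (b c : nat -> R[i]), factorization a B C b c,
      p <> 0 ->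
        (forall e : bool, exists b c : nat -> R[i],
           factorization a (B1 e) (C1 e) b c) /\
        (forall (U V : {poly R[i]}) (u v : nat -> R[i]),
           factorization a U V u v ->
           exists (e : bool) (b c : nat -> R[i]),
             factorization a (B1 e) (C1 e) b c /\
             equivalent_factorizations u v b c)
    & p = 0 -> q + 4 * r <> 0 -> q <> 0 ->
        (exists b c : nat -> R[i],
           factorization a B2 C2 b c \/ factorization a B3 C3 b c) /\
        (forall (U V : {poly R[i]}) (u v : nat -> R[i]),
           factorization a U V u v ->
           exists b c : nat -> R[i],
             (factorization a B2 C2 b c \/ factorization a B3 C3 b c) /\
             equivalent_factorizations u v b c)].
Proof.
move=> rC B1 C1 B2 C2 B3 C3.
have aP := standard_lds4_std4 a_std.
have two0 : 2%:R != 0 :> R[i] by rewrite pnatr_eq0.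
have rC0 : rC != 0 by rewrite intr_eq0; apply/eqP.
have sqrt_r0 : sqrt_r != 0.
  by apply: contraNneq rC0 => sr0; rewrite /rC -sqrt_rE sr0 expr0n.
have q4rE : (q + 4 * r)%:~R = q%:~R + 4 * rC.
  by rewrite rmorphD rmorphM.
rewrite q4rE in sqrt_plusE sqrt_minusE sqrt_q4rE.
have B1E e : B1 e = 'X^2 - ((sqrt_plus + (-1) ^+ e * sqrt_minus)
                             / (2 * sqrt_r)) *: 'X + 1%:P by rewrite polyC1.
have B2E : B2 = 'X^2 - 0 *: 'X + 1%:P by rewrite polyC1 scale0r subr0.
have fact1 e : factorization a (B1 e) (C1 e)
    (lucas ((sqrt_plus + (-1) ^+ e * sqrt_minus) / (2 * sqrt_r)) 1)
    (lucas ((sqrt_plus - (-1) ^+ e * sqrt_minus) / 2) rC).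
  have sgnE : ((-1) ^+ e * sqrt_minus) ^+ 2 = sqrt_minus ^+ 2.
    by rewrite exprMn sqrr_sign mul1r.
  rewrite B1E /C1; move: (_ * sqrt_minus) sgnE => sm smE; rewrite sqrt_minusE in smE.
  apply: (factorizationP (K := R[i]) aP); last by rewrite mul1r.
    have -> : (sqrt_plus + sm) / (2 * sqrt_r) * ((sqrt_plus - sm) / 2)
              = (sqrt_plus ^+ 2 - sm ^+ 2) / (4 * sqrt_r) by field.
    by rewrite sqrt_plusE smE; field.
  have -> : rC * ((sqrt_plus + sm) / (2 * sqrt_r)) ^+ 2
            + 1 * ((sqrt_plus - sm) / 2) ^+ 2 - 4 * (1 * rC)
            = (sqrt_plus ^+ 2 + sm ^+ 2) / 2 - 4 * rC.
    by rewrite /rC -sqrt_rE; field.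
  by rewrite sqrt_plusE smE; field.
split; first by exists (B1 false), (C1 false); do 2!eexists; apply: fact1.
  move=> p0; split=> [e|U V u v uvF]; first by do 2!eexists; apply: fact1.
  have pC0 : p%:~R != 0 :> R[i] by rewrite intr_eq0; apply/eqP.
  have [|h [k [h' [k' [uP vP pE qE rE]]]]] :=
    factorization_parameters aP two0 rC0 _ uvF; first by rewrite pC0.
  have q4r : q%:~R + 4 * rC = k' * h ^+ 2 + k * h' ^+ 2.
    by rewrite -qE /rC -rE; ring.
  rewrite q4r -pE in sqrt_plusE sqrt_minusE.
  rewrite -rE in sqrt_rE; rewrite /rC -rE in rC0.
  have [l [e [lE hE h'E]]] :=
    normalized_parameters rC0 sqrt_rE sqrt_plusE sqrt_minusE.
  exists e; do 2!eexists; split; first exact: fact1.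
  left; rewrite -hE -h'E /rC -rE; apply: normalized_product => //.
  by apply: contraNneq rC0 => l0; rewrite -lE l0 expr0n /= mul0r.
move=> p0 q4r0 _.
have fact2 : factorization a B2 C2 (lucas 0 1) (lucas sqrt_q4r rC).
  rewrite B2E; apply: (factorizationP (K := R[i]) aP); rewrite ?p0 ?mul0r ?mul1r //.
  by rewrite sqrt_q4rE; ring.
split=> [|U V u v uvF]; first by do 2!eexists; left; apply: fact2.
exists (lucas 0 1), (lucas sqrt_q4r rC); split; first by left.
have q4rC0 : q%:~R + 4 * rC != 0 by rewrite -q4rE intr_eq0; apply/eqP.
have [|h [k [h' [k' [uP vP pE qE rE]]]]] :=
  factorization_parameters aP two0 rC0 _ uvF; first by rewrite q4rC0 orbT.
(* Either factor can be the one with vanishing [h], hence the neutral names. *)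
have equiv1 h1 k1 h2 k2 u1 u2 : is_lucas h1 k1 u1 -> is_lucas h2 k2 u2 ->
    h1 = 0 -> k1 * h2 ^+ 2 = q%:~R + 4 * rC -> k1 * k2 = rC ->
  equivalent_products u1 u2 (lucas 0 1) (lucas sqrt_q4r rC).
  move=> u1P u2P h10 qE1 rE1; rewrite h10 in u1P.
  have [l lE dlE] : exists2 l, l ^+ 2 = k1 & sqrt_q4r * l = k1 * h2.
    by apply: sqrt_matching; rewrite sqrt_q4rE -qE1; ring.
  have l0 : l != 0.
    by apply: contraNneq rC0 => l0; rewrite -rE1 -lE l0 expr0n /= mul0r.
  have -> : sqrt_q4r = l * h2.
    by apply: (mulIf l0); rewrite dlE -lE; ring.
  rewrite -rE1; have := normalized_product l0 lE u1P u2P.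
  by rewrite mul0r.
have /eqP : h * h' = 0 by rewrite pE p0.
rewrite mulf_eq0 => /orP[] /eqP h0; [left | right].
  by apply: (equiv1 _ _ _ _ _ _ uP vP h0) => //; rewrite -qE /rC -rE h0; ring.
apply: (equiv1 _ _ _ _ _ _ vP uP h0); last by rewrite mulrC.
by rewrite -qE /rC -rE h0; ring.
Qed.
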